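(* Let $n\ge 1$ be an integer and let $A\subseteq C_n=\{0,1,-1\}^n\subseteq\mathbb{R}^n$ satisfy: (a) $e_i\in A$ for $i=1,\dots,n$; and (b) $A$ is symmetric, that is, if $x\in A$ then $-x\in A$. Then there exists a subset $B\subseteq A$ such that $|B|=n$ and $x+y\notin A$ for every $x,y\in B$.
   Context: $e_1,\dots,e_n$ denotes the standard basis of $\mathbb{R}^n$. Sums $x+y$ are taken in $\mathbb{R}^n$. *)

(* Defs.v *)
From mathcomp Require Import all_boot all_order all_algebra.
From mathcomp Require Import all_classical reals.

Set Implicit Arguments.
Unset Strict Implicit.
Unset Printing Implicit Defensive.

Import GRing.Theory Num.Theory.

Local Open Scope classical_set_scope.
Local Open Scope ring_scope.

Definition sign_cube (R : realType) (n : nat) : set 'rV[R]_n :=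
  [set x : 'rV[R]_n | forall i : 'I_n, x ord0 i \in [:: 0; 1; -1]].

Definition std_basis (R : realType) (n : nat) (i : 'I_n) : 'rV[R]_n :=
  delta_mx ord0 i.

Arguments sign_cube R n : clear implicits.
Arguments std_basis R {n} i.

(* Main.v *)
(** Start from the standard basis and, as long as two distinct members [v_i], [v_j]
    have [v_i + v_j] in [A], replace [v_i] by [v_i + v_j]. The family stays a basis
    of vectors with coordinate sum at least 1, so each step increases the total of
    all coordinates by at least 1; this total is at most [n * n], so the process
    stops. At the end no sum of two distinct members lies in [A], and twice a nonzero
    vector of the sign cube is never in the sign cube. *)
Require Import Defs.
From mathcomp Require Import all_boot all_order all_algebra.
From mathcomp Require Import all_classical reals.
From mathcomp Require Import lra.

Import Order.TTheory GRing.Theory Num.Theory.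

Local Open Scope classical_set_scope.
Local Open Scope ring_scope.

Definition coord_sum {R : pzRingType} {n : nat} (x : 'rV[R]_n) : R :=
  \sum_k x ord0 k.

Lemma coord_sumD {R : pzRingType} {n : nat} (x y : 'rV[R]_n) :
  coord_sum (x + y) = coord_sum x + coord_sum y.
Proof. by rewrite /coord_sum -big_split; apply: eq_bigr => k _; rewrite mxE. Qed.

Lemma coord_sum_std_basis {R : realType} {n : nat} (i : 'I_n) :
  coord_sum (std_basis R i) = 1.
Proof.
rewrite /coord_sum (bigD1 i) //= big1 ?mxE ?eqxx ?addr0 // => k ki.
by rewrite mxE (negPf ki) andbF.
Qed.

Lemma sign_cube_coord_sum_le {R : realType} {n : nat} (x : 'rV[R]_n) :
  sign_cube R n x -> coord_sum x <= n%:R.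
Proof.
move=> xC; rewrite -[n in n%:R]card_ord -sum1_card natr_sum.
apply: ler_sum => k _; have := xC k.
by rewrite !inE => /or3P[] /eqP ->; lra.
Qed.

Lemma sign_cube_double {R : realType} {n : nat} (x : 'rV[R]_n) :
  sign_cube R n x -> sign_cube R n (x + x) -> x = 0.
Proof.
move=> xC xxC; apply/rowP => k; have := xC k; have := xxC k.
rewrite !mxE !inE => /or3P[] /eqP xx /or3P[] /eqP x1; lra.
Qed.

Lemma add_row_unitmx {R : comUnitRingType} {n : nat} (M : 'M[R]_n) (i j : 'I_n) :
  i != j -> M \in unitmx -> (1%:M + delta_mx i j) *m M \in unitmx.
Proof.
move=> ij MU; rewrite unitmx_mul MU andbT.
(* For [i != j] the square of [delta_mx i j] vanishes, so [1%:M - delta_mx i j] is the inverse of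
   the elementary factor. *)
apply: (proj1 (@mulmx1_unit _ _ _ (1%:M - delta_mx i j) _)).
rewrite mulmxDl mul1mx mulmxBr mulmx1 mul_delta_mx_0 1?eq_sym //.
by rewrite subr0 subrK.
Qed.

(** Lets the replacement of one basis vector by a sum be performed as a left multiplication, under
    which invertibility persists. *)
Lemma row_add_row {R : pzRingType} {n : nat} (M : 'M[R]_n) (i j k : 'I_n) :
  row k ((1%:M + delta_mx i j) *m M) =
  if k == i then row i M + row j M else row k M.
Proof.
rewrite mulmxDl mul1mx linearD /= row_mul.
suff -> : row k (delta_mx i j : 'M[R]_n) = (k == i)%:R *: delta_mx 0 j.
  rewrite -scalemxAl -rowE.
  by case: eqP => [->|_]; rewrite ?scale1r // scale0r addr0.
by apply/rowP => l; rewrite !mxE eqxx /=; case: eqP => _ /=; rewrite ?mul1r ?mul0r.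
Qed.

Lemma row_inj_unitmx {R : fieldType} {n : nat} (M : 'M[R]_n) :
  M \in unitmx -> injective (fun i => row i M).
Proof.
move=> MU i j; rewrite !rowE => /(can_inj (mulmxK MU)) /rowP /(_ i) /eqP.
by rewrite !mxE !eqxx /=; have [//|_] := eqVneq i j; rewrite oner_eq0.
Qed.

(** The basis is held as the rows of an invertible matrix. The number [k] bounds the replacements
    still possible: each one raises the total by at least 1, so the strict inequality survives
    lowering [k] by 1. *)
Lemma ex_sum_avoiding_basis {R : realFieldType} {n : nat} (A : set 'rV[R]_n) :
  (forall x, A x -> coord_sum x <= n%:R) ->
  forall (k : nat) (M : 'M[R]_n), M \in unitmx ->
    (forall i, A (row i M)) -> (forall i, 1 <= coord_sum (row i M)) ->
    (n * n)%:R < \sum_i coord_sum (row i M) + k%:R ->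
  exists N : 'M[R]_n, [/\ N \in unitmx, forall i, A (row i N)
    & forall i j, i != j -> ~ A (row i N + row j N)].
Proof.
move=> Ale; elim=> [|k IHk] M MU MA M1 Mk.
  (* With [k = 0] the total would exceed [n * n], although each of the [n] rows contributes at most
     [n]. *)
  suff : \sum_i coord_sum (row i M) <= (n * n)%:R by move: Mk; lra.
  rewrite natrM -[X in X%:R * _]card_ord -sum1_card natr_sum mulr_suml.
  by apply: ler_sum => i _; rewrite mul1r Ale.
case: (pselect (exists i j, i != j /\ A (row i M + row j M))); last first.
  by move=> avoid; exists M; split=> // i j ij Aij; apply: avoid; exists i, j.
move=> [i [j [ij Aij]]].
apply: (IHk ((1%:M + delta_mx i j) *m M)); first exact: add_row_unitmx.
- by move=> l; rewrite row_add_row; case: eqP.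
- move=> l; rewrite row_add_row; case: eqP => // _.
  by rewrite coord_sumD; have := M1 i; have := M1 j; lra.
rewrite (bigD1 i) //= row_add_row eqxx coord_sumD.
under eq_bigr => l li do rewrite row_add_row (negPf li).
(* The total grows by the coordinate sum of row [j], which is at least 1 and pays for the unit lost
   in [k]. *)
by move: Mk (M1 j); rewrite (bigD1 i) //= -natr1; lra.
Qed.

Theorem theorem3 (R : realType) (n : nat) (hn : (1 <= n)%N)
  (A : set 'rV[R]_n)
  (hA : A `<=` sign_cube R n)
  (hbasis : forall i : 'I_n, A (std_basis R i))
  (hsym : forall x : 'rV[R]_n, A x -> A (- x)) :
  exists B : set 'rV[R]_n,
    [/\ B `<=` A,
        (B #= `I_n)%card
      & forall x y : 'rV[R]_n, B x -> B y -> ~ A (x + y)].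
Proof.
have rowI (i : 'I_n) : row i 1%:M = std_basis R i by rewrite row1.
have [|||||N [NU NA Nsum]] :=
  (* The extra 1 in [(n * n).+1] gives the strict inequality as soon as the initial total is
     nonnegative. *)
  @ex_sum_avoiding_basis R n A _ (n * n).+1 1%:M.
- by move=> x /hA /sign_cube_coord_sum_le.
- exact: unitmx1.
- by move=> i; rewrite rowI.
- by move=> i; rewrite rowI coord_sum_std_basis.
- rewrite -natr1; have : 0 <= \sum_(i < n) coord_sum (row i (1%:M : 'M[R]_n)).
    by apply: sumr_ge0 => i _; rewrite rowI coord_sum_std_basis.
  by lra.
exists (range (fun i => row i N)); split.
- by move=> _ [i _ <-].
- rewrite (card_eqr card_II).
  by apply: inj_card_eq => i j _ _; apply: row_inj_unitmx.
move=> _ _ [i _ <-] [j _ <-]; have [<-|/Nsum //] := eqVneq i j.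
move=> /hA /(sign_cube_double _ (hA _ (NA i))) Ni0.
(* A zero row [i] means that the [i]-th unit row vector times [N] is 0, which the invertibility of
   [N] excludes. *)
move: (mulmxK NU (delta_mx 0 i : 'rV_n)); rewrite -rowE Ni0 mul0mx.
by move=> /rowP /(_ i) /eqP; rewrite !mxE !eqxx eq_sym oner_eq0.
Qed.
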